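(* $$\sum_{k=0}^{\infty}\frac{\binom{2k}{k}^4\binom{4k}{2k}}{2^{16k}}\Big\{(120k^2+34k+3)(H_{2k}-2H_k)+68k+9\Big\}=\frac{128\log 2}{\pi^2}.$$
   Context: For a nonnegative integer $n$, $H_n=\sum_{j=1}^{n}\frac{1}{j}$ denotes the classical harmonic number, with $H_0=0$. $\log$ is the natural logarithm. *)

(* Defs.v *)
From Stdlib Require Import Reals.
From Coquelicot Require Import Coquelicot.
Open Scope R_scope.

(* [sum_n_m a 1 0] is the empty sum, hence [harmonic 0 = 0]. *)
Definition harmonic (n : nat) : R := sum_n_m (fun j : nat => / INR j) 1 n.

(* Main.v *)
Require Import Defs.
From Stdlib Require Import Reals Lra Lia.
From Coquelicot Require Import Coquelicot.
Open Scope R_scope.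

(** The series is the derivative at [x = 0] of a one-parameter family of series
    that a WZ pair evaluates.  With rising factorials [(a)_n], put

      w(n,x) = (1/2)_{2n} (1/2)_n^4 / (2n)!
               * ( (x+1/2)_n / ((x+1)_n (x+1)_{2n+1}) )^2

    and let [p(n,x)] be the polynomial [num] below, so that at [x = 0] the term
    [w p] is the summand of Guillera's series
    sum_n C(2n,n)^4 C(4n,2n) / 2^{16n} (120 n^2 + 34 n + 3) = 32 / pi^2.
    The derivative of [ln w] at [x = 0] is a combination of harmonic numbers in
    which only [2 (H_{2n} - 2 H_n)] and a rational function survive, so the
    derivative of [w p] is exactly twice the summand of the theorem
    ([half_dterm_0]).

    With [rho(x) = ((x+1/2)/(x+1))^4], the difference
    [rho(x) w(n,x+1) p(n,x+1) - w(n,x) p(n,x)] telescopes in [n]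
    ([wz_identity]), and so does its derivative in [x] ([dwz_identity]).  Summed
    over [n], this relates the sum [S(x)] of the terms and the sum [T(x)] of
    their derivatives to their values at [x + 1]:

      S(x) = rho(x) S(x+1),
      T(x) = rho(x) ((ln rho)'(x) S(x+1) + T(x+1)).

    Let [u_K] be the product of the [(2j+1)/(2j+2)], [j < K].  Iterating from
    [x = 0] gives

      S(0) = u_K^4 S(K),
      T(0) = u_K^4 T(K) + S(0) * sum_{j<K} (ln rho)'(j).

    For large [x] the term [n = 0] dominates: [S(x) ~ 32 x^2], while
    [T(x) = O(x)].  Wallis' product gives [u_K^4 ~ 1/(pi K)^2]; hence
    [S(0) = 32/pi^2] and the first part of [T(0)] vanishes in the limit.  Finally
    sum_{j<K} (ln rho)'(j) = 8 (H_{2K} - H_K) tends to [8 ln 2], whence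
    [T(0) = 256 ln 2 / pi^2], twice the claimed value. *)

(** * The WZ pair *)

Definition weight_ratio (n x : R) : R :=
  (4 * n + 1) * (4 * n + 3) * (2 * n + 1) ^ 3 * (2 * x + 2 * n + 1) ^ 2
  / (512 * (n + 1) * ((x + n + 1) * (x + 2 * n + 2) * (x + 2 * n + 3)) ^ 2).

(** The weight [w(n,x)] of the introduction, given by its ratio in [n] because
    every argument about it is an induction on [n]. *)
Fixpoint weight (n : nat) (x : R) : R :=
  match n with
  | O => / (x + 1) ^ 2
  | S m => weight m x * weight_ratio (INR m) x
  end.

Fixpoint dlog_weight (n : nat) (x : R) : R :=
  match n with
  | O => - (2 / (x + 1))
  | S m => dlog_weight m x
           + (4 / (2 * x + 2 * INR m + 1) - 2 / (x + INR m + 1)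
              - 2 / (x + 2 * INR m + 2) - 2 / (x + 2 * INR m + 3))
  end.

(** The coefficients solve the linear system that telescoping imposes in
    [wz_identity].  At [x = 0] the polynomial is
    [(2n+1)^2 (120 n^2 + 34 n + 3)], at [n = 0] it is
    [(2x+1)^2 (8 x^2 + 12 x + 3)]. *)
Definition num (n x : R) : R :=
  (3 + 24 * x + 68 * x ^ 2 + 80 * x ^ 3 + 32 * x ^ 4)
  + n * (46 + 288 * x + 488 * x ^ 2 + 256 * x ^ 3)
  + n ^ 2 * (268 + 992 * x + 768 * x ^ 2)
  + n ^ 3 * (616 + 1024 * x) + 480 * n ^ 4.

Definition dnum (n x : R) : R :=
  (24 + 136 * x + 240 * x ^ 2 + 128 * x ^ 3)
  + n * (288 + 976 * x + 768 * x ^ 2)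
  + n ^ 2 * (992 + 1536 * x) + 1024 * n ^ 3.

(** The WZ certificate: as a multiple of [weight], the quantity whose forward
    difference in [n] is the effect of the shift [x -> x + 1]. *)
Definition cert (n x : R) : R := 32 * n * (4 * n + 4 * x + 1) * (x + 2 * n + 1) ^ 2.
Definition dcert (n x : R) : R :=
  64 * n * (x + 2 * n + 1) * (6 * x + 8 * n + 3).

(** The quotient [g(x+1) / g(x)] for [g(x) = (Gamma(x+1/2) / Gamma(x+1))^4],
    the normalization under which the sum of the terms has period 1; using the
    quotient avoids the Gamma function. *)
Definition shift_factor (x : R) : R := ((2 * x + 1) / (2 * x + 2)) ^ 4.
Definition dlog_shift (x : R) : R := 8 * (/ (2 * x + 1) - / (2 * x + 2)).

Lemma weight_shift n x : - / 2 < x ->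
  shift_factor x * weight n (x + 1) =
  weight n x * ((2 * x + 1) * (2 * x + 2 * INR n + 1)
           / (4 * (x + INR n + 1) * (x + 2 * INR n + 2))) ^ 2.
Proof.
  intros Hx; induction n as [|n IH]; cbn [weight].
  - unfold shift_factor; simpl INR; field; lra.
  - rewrite <- Rmult_assoc, IH, S_INR; pose proof (pos_INR n).
    unfold weight_ratio; field; repeat split; lra.
Qed.

(** After [weight_shift], all four terms are rational multiples of [weight n x];
    what remains is an identity of rational functions. *)
Lemma wz_identity n x : - / 2 < x ->
  shift_factor x * (weight n (x + 1) * num (INR n) (x + 1))
  - weight n x * num (INR n) x
  = weight (S n) x * cert (INR (S n)) x - weight n x * cert (INR n) x.
Proof.
  intros Hx; rewrite <- Rmult_assoc, weight_shift by assumption.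
  cbn [weight]; rewrite S_INR; pose proof (pos_INR n).
  unfold weight_ratio, num, cert; field; repeat split; lra.
Qed.

Lemma is_derive_weight n x : - / 2 < x ->
  is_derive (weight n) x (weight n x * dlog_weight n x).
Proof.
  intros Hx; induction n as [|n IH]; cbn [weight dlog_weight].
  - auto_derive; [nra | field; lra].
  - pose proof (pos_INR n).
    unfold weight_ratio; auto_derive.
    + split; [exists (weight n x * dlog_weight n x); exact IH|].
      split; [|exact I].
      repeat (apply Rmult_integral_contrapositive; split); lra.
    + replace (Derive (fun y => weight n y) x) with (weight n x * dlog_weight n x)
        by (symmetry; apply is_derive_unique; exact IH).
      field; repeat split; lra.
Qed.

Lemma is_derive_weighted n (p p' : R -> R) x : - / 2 < x ->
  is_derive p x (p' x) ->
  is_derive (fun y => weight n y * p y) x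
    (weight n x * (dlog_weight n x * p x + p' x)).
Proof.
  intros Hx Hp; pose proof (is_derive_weight n x Hx) as HA.
  auto_derive.
  - split; [eexists; exact HA|]. split; [eexists; exact Hp| exact I].
  - replace (Derive (fun y => weight n y) x) with (weight n x * dlog_weight n x)
      by (symmetry; apply is_derive_unique; exact HA).
    replace (Derive (fun y => p y) x) with (p' x)
      by (symmetry; apply is_derive_unique; exact Hp). ring.
Qed.

Lemma is_derive_num n x : is_derive (num n) x (dnum n x).
Proof. unfold num, dnum; auto_derive; [exact I | ring]. Qed.

Lemma is_derive_cert n x : is_derive (cert n) x (dcert n x).
Proof. unfold cert, dcert; auto_derive; [exact I | ring]. Qed.

Lemma is_derive_shift_factor x : - / 2 < x ->
  is_derive shift_factor x (shift_factor x * dlog_shift x).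
Proof.
  intros Hx; unfold shift_factor, dlog_shift; auto_derive; [lra | field; lra].
Qed.

Definition term n x := weight n x * num (INR n) x.
Definition dterm n x :=
  weight n x * (dlog_weight n x * num (INR n) x + dnum (INR n) x).
Definition potential n x := weight n x * cert (INR n) x.
Definition dpotential n x :=
  weight n x * (dlog_weight n x * cert (INR n) x + dcert (INR n) x).

(** [wz_identity] holds on the whole interval [x > -1/2], so both sides may be
    differentiated.  Doing so termwise spares any interchange of derivative and
    infinite sum. *)
Lemma dwz_identity n x : - / 2 < x ->
  shift_factor x * (dlog_shift x * term n (x + 1) + dterm n (x + 1)) - dterm n x
  = dpotential (S n) x - dpotential n x.
Proof.
  intros Hx.
  assert (dl : is_derive (fun y => shift_factor y * term n (y + 1) - term n y) x
     (shift_factor x * (dlog_shift x * term n (x + 1) + dterm n (x + 1)) - dterm n x)).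
  { assert (E1 : is_derive (term n) (x + 1) (dterm n (x + 1)))
      by (apply is_derive_weighted; [lra | apply is_derive_num]).
    assert (E2 : is_derive (term n) x (dterm n x))
      by (apply is_derive_weighted; [lra | apply is_derive_num]).
    pose proof (is_derive_shift_factor x Hx) as E3.
    auto_derive.
    - repeat split; eexists; eassumption.
    - replace (Derive (fun y => term n y) (x + 1)) with (dterm n (x + 1))
        by (symmetry; apply is_derive_unique; exact E1).
      replace (Derive (fun y => term n y) x) with (dterm n x)
        by (symmetry; apply is_derive_unique; exact E2).
      replace (Derive (fun y => shift_factor y) x) with (shift_factor x * dlog_shift x)
        by (symmetry; apply is_derive_unique; exact E3). ring. }
  assert (dr : is_derive (fun y => potential (S n) y - potential n y) x
     (dpotential (S n) x - dpotential n x)).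
  { apply (is_derive_minus (potential (S n)) (potential n));
      apply is_derive_weighted; try lra; apply is_derive_cert. }
  apply is_derive_unique in dr; rewrite <- dr; symmetry.
  apply is_derive_unique.
  apply (is_derive_ext_loc
    (fun y => shift_factor y * term n (y + 1) - term n y)); [|exact dl].
  apply (filter_imp (fun y => - / 2 < y)).
  - intros y Hy; apply wz_identity; exact Hy.
  - apply (open_gt (- / 2)); exact Hx.
Qed.

(** * Bounds on the summand and its derivative *)

Ltac nonneg := repeat first
  [ assumption | lra
  | apply Rplus_le_le_0_compat | apply Rmult_le_pos | apply pow_le
  | apply pos_INR ].

(** After [4n+1, 4n+3 <= 4(n+1)], [2n+1 <= 2(n+1)], [2x+2n+1 <= 2(x+n+1)] and
    [x+2n+2, x+2n+3 >= 2(n+1)] everything cancels, and [1/16] is left. *)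
Lemma weight_ratio_bounds n x : 0 <= n -> 0 <= x -> 0 <= weight_ratio n x <= / 16.
Proof.
  intros Hn Hx; unfold weight_ratio.
  set (D := 512 * _ * _).
  assert (HD : 0 < D).
  { unfold D. repeat apply Rmult_lt_0_compat; lra. }
  split.
  - apply Rle_div_r; [exact HD|]. rewrite Rmult_0_l; nonneg.
  - apply Rle_div_l; [exact HD|].
    apply Rle_trans with
      ((4 * (n + 1)) * (4 * (n + 1)) * (2 * (n + 1)) ^ 3 * (2 * (x + n + 1)) ^ 2).
    + repeat apply Rmult_le_compat; nonneg.
    + apply Rle_trans with
        (/ 16 * (512 * (n + 1) * ((x + n + 1) * (2 * (n + 1)) * (2 * (n + 1))) ^ 2)).
      * right; field.
      * apply Rmult_le_compat_l; [lra|]. unfold D.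
        apply Rmult_le_compat_l; [lra|]. apply pow_incr. split; [nonneg|].
        repeat apply Rmult_le_compat; nonneg.
Qed.

Lemma weight_nonneg n x : 0 <= x -> 0 <= weight n x.
Proof.
  intros Hx; induction n as [|n IH]; cbn [weight].
  - apply Rlt_le, Rinv_0_lt_compat, pow_lt; lra.
  - apply Rmult_le_pos; [exact IH|].
    apply weight_ratio_bounds; [apply pos_INR | exact Hx].
Qed.

Lemma weight_S_le n x b : 0 <= x -> weight n x <= b -> weight (S n) x <= / 16 * b.
Proof.
  intros Hx Hb; cbn [weight]; rewrite (Rmult_comm (/ 16)).
  pose proof (weight_ratio_bounds (INR n) x (pos_INR n) Hx).
  apply Rmult_le_compat; try lra. now apply weight_nonneg.
Qed.

Lemma weight_le n x : 0 <= x -> weight n x <= (/ 16) ^ n / (x + 1) ^ 2.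
Proof.
  intros Hx; induction n as [|n IH].
  - cbn [weight pow]; right; field; lra.
  - apply (weight_S_le n x _ Hx) in IH; eapply Rle_trans; [exact IH|].
    right; simpl; field; lra.
Qed.

(** From the second term on, the decay in [x] improves from power 2 to power 6.
    Against a numerator of degree 4 this makes only the term [n = 0] matter for
    large [x]. *)
Lemma weight_S_le_pow6 n x : 0 <= x -> weight (S n) x <= (/ 16) ^ n / (x + 1) ^ 6.
Proof.
  intros Hx; induction n as [|n IH].
  - unfold weight, weight_ratio; simpl INR.
    apply Rle_trans with
      (3 * (2 * (x + 1)) ^ 2
        / (512 * (x + 1) ^ 2 * ((x + 1) * (x + 1) * (x + 1)) ^ 2)).
    + replace (/ (x + 1) ^ 2 * _) with
        (3 * (2 * x + 1) ^ 2
         / (512 * (x + 1) ^ 2 * ((x + 1) * (x + 2) * (x + 3)) ^ 2))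
        by (field; lra).
      apply Rmult_le_compat; [nonneg | | |].
      * apply Rlt_le, Rinv_0_lt_compat. repeat apply Rmult_lt_0_compat; lra.
      * apply Rmult_le_compat_l; [lra|]. apply pow_incr; lra.
      * apply Rinv_le_contravar.
        { repeat apply Rmult_lt_0_compat; lra. }
        apply Rmult_le_compat_l; [nonneg|]. apply pow_incr. split; [nonneg|].
        repeat apply Rmult_le_compat; nonneg.
    + replace (3 * (2 * (x + 1)) ^ 2 / _) with (12 / 512 * / (x + 1) ^ 6)
        by (field; lra).
      unfold Rdiv; apply Rmult_le_compat_r; [|simpl; lra].
      apply Rlt_le, Rinv_0_lt_compat, pow_lt; lra.
  - apply (weight_S_le _ x _ Hx) in IH; eapply Rle_trans; [exact IH|].
    right; simpl; field; lra.
Qed.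

(** The factor [/ (x + 1)] is what makes the sum of the derivatives [O(x)] when
    the sum itself is of order [x ^ 2]. *)
Lemma dlog_weight_bound n x : 0 <= x ->
  Rabs (dlog_weight n x) <= (10 * INR n + 2) / (x + 1).
Proof.
  intros Hx; induction n as [|n IH].
  - cbn [dlog_weight]; rewrite Rabs_Ropp; simpl INR.
    rewrite Rabs_pos_eq; [right; f_equal; ring|].
    apply Rlt_le, Rdiv_lt_0_compat; lra.
  - cbn [dlog_weight]; rewrite S_INR; pose proof (pos_INR n) as Hn.
    set (m := INR n) in *.
    assert (inv : forall d, x + 1 <= d -> 0 <= / d <= / (x + 1)).
    { intros d Hd; split.
      - apply Rlt_le, Rinv_0_lt_compat; lra.
      - apply Rinv_le_contravar; lra. }
    replace (4 / (2 * x + 2 * m + 1)) with (2 * (2 * / (2 * x + 2 * m + 1)))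
      by (field; lra).
    assert (H0 : 0 <= 2 * / (2 * x + 2 * m + 1) <= 2 * / (x + 1)).
    { replace (2 * / (2 * x + 2 * m + 1)) with (/ (x + m + / 2)) by (field; lra).
      replace (2 * / (x + 1)) with (/ ((x + 1) / 2)) by (field; lra).
      split.
      - apply Rlt_le, Rinv_0_lt_compat; lra.
      - apply Rinv_le_contravar; lra. }
    pose proof (inv (x + m + 1) ltac:(lra)).
    pose proof (inv (x + 2 * m + 2) ltac:(lra)).
    pose proof (inv (x + 2 * m + 3) ltac:(lra)).
    apply Rabs_le_between in IH.
    apply Rabs_le_between; unfold Rdiv in *; lra.
Qed.

(** The constant 4 comes from [n = 1]; from there on
    [((n + 2) / (n + 1)) ^ 5 <= (3 / 2) ^ 5 < 8]. *)
Lemma pow5_geom n : (INR n + 1) ^ 5 * (/ 16) ^ n <= 4 * (/ 2) ^ n.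
Proof.
  assert (key : (INR n + 1) ^ 5 <= 4 * 8 ^ n).
  { destruct n as [|n]; [simpl; lra|].
    induction n as [|n IH]; [simpl; lra|].
    rewrite !S_INR in *; pose proof (pos_INR n).
    apply Rle_trans with ((3 / 2 * (INR n + 1 + 1)) ^ 5).
    - apply pow_incr; lra.
    - rewrite Rpow_mult_distr.
      change (8 ^ S (S n)) with (8 * 8 ^ S n).
      assert (0 <= (INR n + 1 + 1) ^ 5) by (apply pow_le; lra).
      replace ((3 / 2) ^ 5) with (243 / 32) by field. lra. }
  replace ((/ 2) ^ n) with (8 ^ n * (/ 16) ^ n).
  - rewrite <- Rmult_assoc. apply Rmult_le_compat_r; [apply pow_le; lra | exact key].
  - rewrite <- Rpow_mult_distr; f_equal; field.
Qed.

Lemma weighted_bound n x c p : 0 <= c -> 0 <= x ->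
  0 <= p <= c * (INR n + 1) ^ 4 * (x + 1) ^ 4 ->
  0 <= weight n x * p <= 4 * c * (x + 1) ^ 2 * (/ 2) ^ n.
Proof.
  intros Hc Hx [Hp0 Hp]; pose proof (weight_nonneg n x Hx) as HA0.
  pose proof (pos_INR n) as Hn.
  split; [now apply Rmult_le_pos|].
  apply Rle_trans with
    ((/ 16) ^ n / (x + 1) ^ 2 * (c * (INR n + 1) ^ 5 * (x + 1) ^ 4)).
  - apply Rmult_le_compat; try assumption; [now apply weight_le|].
    eapply Rle_trans; [exact Hp|].
    apply Rmult_le_compat_r; [apply pow_le; lra|].
    apply Rmult_le_compat_l; [exact Hc|].
    apply Rle_pow; [lra | lia].
  - replace (_ / _ * _) with
      (c * (x + 1) ^ 2 * ((INR n + 1) ^ 5 * (/ 16) ^ n)) by (field; lra).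
    replace (4 * c * (x + 1) ^ 2 * (/ 2) ^ n) with
      (c * (x + 1) ^ 2 * (4 * (/ 2) ^ n)) by ring.
    apply Rmult_le_compat_l; [|apply pow5_geom].
    apply Rmult_le_pos; [exact Hc | apply pow_le; lra].
Qed.

Lemma weighted_derivative_bound n x c p p' : 0 <= c -> 0 <= x ->
  0 <= p <= c * (INR n + 1) ^ 4 * (x + 1) ^ 4 ->
  0 <= p' <= c * (INR n + 1) ^ 4 * (x + 1) ^ 3 ->
  Rabs (weight n x * (dlog_weight n x * p + p')) <= 44 * c * (x + 1) * (/ 2) ^ n.
Proof.
  intros Hc Hx [Hp0 Hp] [Hp0' Hp']; pose proof (weight_nonneg n x Hx) as HA0.
  pose proof (pos_INR n) as Hn.
  assert (HLp : Rabs (dlog_weight n x * p + p')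
                <= 11 * c * (INR n + 1) ^ 5 * (x + 1) ^ 3).
  { eapply Rle_trans; [apply Rabs_triang|].
    rewrite Rabs_mult, (Rabs_pos_eq p), (Rabs_pos_eq p') by assumption.
    apply Rle_trans with
      ((10 * (INR n + 1)) / (x + 1) * (c * (INR n + 1) ^ 4 * (x + 1) ^ 4)
       + c * (INR n + 1) ^ 5 * (x + 1) ^ 3).
    - apply Rplus_le_compat.
      + apply Rmult_le_compat; try assumption; [apply Rabs_pos|].
        eapply Rle_trans; [now apply dlog_weight_bound|].
        apply Rmult_le_compat_r; [|lra].
        apply Rlt_le, Rinv_0_lt_compat; lra.
      + eapply Rle_trans; [exact Hp'|].
        apply Rmult_le_compat_r; [apply pow_le; lra|].
        apply Rmult_le_compat_l; [exact Hc|].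
        apply Rle_pow; [lra | lia].
    - right; field; lra. }
  rewrite Rabs_mult, (Rabs_pos_eq (weight n x)) by assumption.
  apply Rle_trans with
    ((/ 16) ^ n / (x + 1) ^ 2 * (11 * c * (INR n + 1) ^ 5 * (x + 1) ^ 3)).
  - apply Rmult_le_compat; try assumption; [apply Rabs_pos | now apply weight_le].
  - replace (_ / _ * _) with
      (11 * c * (x + 1) * ((INR n + 1) ^ 5 * (/ 16) ^ n)) by (field; lra).
    replace (44 * c * (x + 1) * (/ 2) ^ n) with
      (11 * c * (x + 1) * (4 * (/ 2) ^ n)) by ring.
    apply Rmult_le_compat_l; [|apply pow5_geom].
    repeat apply Rmult_le_pos; lra.
Qed.

Lemma num_bounds n x : 0 <= n -> 0 <= x ->
  0 <= num n x <= 1024 * (n + 1) ^ 4 * (x + 1) ^ 4.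
Proof.
  intros Hn Hx; unfold num; split; [nonneg|].
  apply Rminus_le_0; ring_simplify; nonneg.
Qed.

Lemma dnum_bounds n x : 0 <= n -> 0 <= x ->
  0 <= dnum n x <= 1024 * (n + 1) ^ 4 * (x + 1) ^ 3.
Proof.
  intros Hn Hx; unfold dnum; split; [nonneg|].
  apply Rminus_le_0; ring_simplify; nonneg.
Qed.

Lemma cert_bounds n x : 0 <= n -> 0 <= x ->
  0 <= cert n x <= 1024 * (n + 1) ^ 4 * (x + 1) ^ 4.
Proof.
  intros Hn Hx; unfold cert; split; [nonneg|].
  apply Rminus_le_0; ring_simplify; nonneg.
Qed.

Lemma dcert_bounds n x : 0 <= n -> 0 <= x ->
  0 <= dcert n x <= 1024 * (n + 1) ^ 4 * (x + 1) ^ 3.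
Proof.
  intros Hn Hx; unfold dcert; split; [nonneg|].
  apply Rminus_le_0; ring_simplify; nonneg.
Qed.

(** * The two sums and their shift relations *)

Definition term_sum x := Series (fun n => term n x).
Definition dterm_sum x := Series (fun n => dterm n x).

Lemma is_series_geom_half c : is_series (fun n => c * (/ 2) ^ n) (2 * c).
Proof.
  replace (2 * c) with (c * / (1 - / 2)) by field.
  apply (is_series_scal_l c (fun n => (/ 2) ^ n)), is_series_geom.
  rewrite Rabs_pos_eq; lra.
Qed.

Lemma ex_series_geom_half f c :
  (forall n, Rabs (f n) <= c * (/ 2) ^ n) -> ex_series f.
Proof.
  intros Hf; apply (ex_series_le f (fun n => c * (/ 2) ^ n)); [exact Hf|].
  eexists; apply is_series_geom_half.
Qed.

Lemma Series_geom_half_bound f c :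
  (forall n, Rabs (f n) <= c * (/ 2) ^ n) -> Rabs (Series f) <= 2 * c.
Proof.
  intros Hf.
  pose proof (is_series_unique _ _ (is_series_geom_half c)) as E.
  rewrite <- E.
  assert (HA : ex_series (fun n => Rabs (f n))).
  { apply (ex_series_geom_half _ c); intros n; rewrite Rabs_Rabsolu; apply Hf. }
  eapply Rle_trans; [apply Series_Rabs, HA|].
  apply Series_le; [|eexists; apply is_series_geom_half].
  intros n; split; [apply Rabs_pos | apply Hf].
Qed.

Lemma is_lim_seq_geom_half f c :
  (forall n, Rabs (f n) <= c * (/ 2) ^ n) -> is_lim_seq f 0.
Proof.
  intros Hf; apply is_lim_seq_abs_0.
  apply (is_lim_seq_le_le (fun _ => 0) _ (fun n => c * (/ 2) ^ n)).
  - intros n; split; [apply Rabs_pos | apply Hf].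
  - apply is_lim_seq_const.
  - replace (Finite 0) with (Rbar_mult c 0) by (simpl; f_equal; ring).
    apply is_lim_seq_scal_l, is_lim_seq_geom. rewrite Rabs_pos_eq; lra.
Qed.

Lemma is_series_telescope f h :
  (forall n, f n = h (S n) - h n) -> h O = 0 -> is_lim_seq h 0 ->
  is_series f 0.
Proof.
  intros Hf H0 Hlim.
  assert (Hsum : forall n, h (S n) = sum_n f n).
  { induction n as [|n IH].
    - rewrite sum_O, Hf, H0; ring.
    - rewrite sum_Sn, <- IH, Hf; unfold plus; simpl; ring. }
  change (is_lim_seq (sum_n f) 0).
  apply (is_lim_seq_ext (fun n => h (S n))); [exact Hsum|].
  now apply is_lim_seq_incr_1 in Hlim.
Qed.

Lemma term_bounds n x : 0 <= x -> 0 <= term n x <= 4096 * (x + 1) ^ 2 * (/ 2) ^ n.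
Proof.
  intros Hx; replace 4096 with (4 * 1024) by ring;
  apply weighted_bound; [lra | exact Hx |].
  apply num_bounds; [apply pos_INR | exact Hx].
Qed.

Lemma potential_bounds n x : 0 <= x ->
  0 <= potential n x <= 4096 * (x + 1) ^ 2 * (/ 2) ^ n.
Proof.
  intros Hx; replace 4096 with (4 * 1024) by ring;
  apply weighted_bound; [lra | exact Hx |].
  apply cert_bounds; [apply pos_INR | exact Hx].
Qed.

Lemma dterm_bound n x : 0 <= x -> Rabs (dterm n x) <= 44 * 1024 * (x + 1) * (/ 2) ^ n.
Proof.
  intros Hx; apply weighted_derivative_bound; [lra | exact Hx | |].
  - apply num_bounds; [apply pos_INR | exact Hx].
  - apply dnum_bounds; [apply pos_INR | exact Hx].
Qed.

Lemma dpotential_bound n x : 0 <= x ->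
  Rabs (dpotential n x) <= 44 * 1024 * (x + 1) * (/ 2) ^ n.
Proof.
  intros Hx; apply weighted_derivative_bound; [lra | exact Hx | |].
  - apply cert_bounds; [apply pos_INR | exact Hx].
  - apply dcert_bounds; [apply pos_INR | exact Hx].
Qed.

Lemma is_series_term x : 0 <= x -> is_series (fun n => term n x) (term_sum x).
Proof.
  intros Hx; apply Series_correct, (ex_series_geom_half _ (4096 * (x + 1) ^ 2)).
  intros n; rewrite Rabs_pos_eq; now apply term_bounds.
Qed.

Lemma is_series_dterm x : 0 <= x -> is_series (fun n => dterm n x) (dterm_sum x).
Proof.
  intros Hx; apply Series_correct, (ex_series_geom_half _ (44 * 1024 * (x + 1))).
  intros n; now apply dterm_bound.
Qed.

(** The telescoped right-hand side of [wz_identity] contributes nothing: [cert]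
    vanishes at [n = 0], and [potential] decays geometrically. *)
Lemma term_sum_shift x : 0 <= x -> term_sum x = shift_factor x * term_sum (x + 1).
Proof.
  intros Hx.
  assert (H0 : is_series (fun n => shift_factor x * term n (x + 1) - term n x) 0).
  { apply (is_series_telescope _ (fun n => potential n x)).
    - intros n; apply wz_identity; lra.
    - unfold potential, cert; simpl INR; ring.
    - apply (is_lim_seq_geom_half _ (4096 * (x + 1) ^ 2)); intros n.
      rewrite Rabs_pos_eq; now apply potential_bounds. }
  assert (H1 : is_series (fun n => shift_factor x * term n (x + 1) - term n x)
                 (shift_factor x * term_sum (x + 1) - term_sum x)).
  { apply (is_series_minus (fun n => shift_factor x * term n (x + 1))
                           (fun n => term n x));
      [|now apply is_series_term].
    apply (is_series_scal_l (shift_factor x) (fun n => term n (x + 1))).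
    apply is_series_term; lra. }
  apply is_series_unique in H0, H1; lra.
Qed.

Lemma dterm_sum_shift x : 0 <= x ->
  dterm_sum x =
  shift_factor x * (dlog_shift x * term_sum (x + 1) + dterm_sum (x + 1)).
Proof.
  intros Hx.
  assert (H0 : is_series
     (fun n => shift_factor x * (dlog_shift x * term n (x + 1) + dterm n (x + 1))
               - dterm n x) 0).
  { apply (is_series_telescope _ (fun n => dpotential n x)).
    - intros n; apply dwz_identity; lra.
    - unfold dpotential, cert, dcert; simpl INR; ring.
    - apply (is_lim_seq_geom_half _ (44 * 1024 * (x + 1))); intros n.
      now apply dpotential_bound. }
  assert (H1 : is_series
     (fun n => shift_factor x * (dlog_shift x * term n (x + 1) + dterm n (x + 1))
               - dterm n x)
     (shift_factor x * (dlog_shift x * term_sum (x + 1) + dterm_sum (x + 1))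
      - dterm_sum x)).
  { apply (is_series_minus
      (fun n => shift_factor x * (dlog_shift x * term n (x + 1) + dterm n (x + 1)))
      (fun n => dterm n x));
      [|now apply is_series_dterm].
    apply (is_series_scal_l (shift_factor x)
      (fun n => dlog_shift x * term n (x + 1) + dterm n (x + 1))).
    apply (is_series_plus (fun n => dlog_shift x * term n (x + 1))
                          (fun n => dterm n (x + 1)));
      [|apply is_series_dterm; lra].
    apply (is_series_scal_l (dlog_shift x) (fun n => term n (x + 1))).
    apply is_series_term; lra. }
  apply is_series_unique in H0, H1; lra.
Qed.

(** The subtracted expression is the term [n = 0]. *)
Lemma term_sum_asymptotic x : 0 <= x ->
  0 <= term_sum x - (2 * x + 1) ^ 2 * (8 * x ^ 2 + 12 * x + 3) / (x + 1) ^ 2 <= 65536.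
Proof.
  intros Hx.
  assert (E : term_sum x = term 0 x + Series (fun n => term (S n) x)).
  { apply Series_incr_1. eexists; now apply is_series_term. }
  replace ((2 * x + 1) ^ 2 * (8 * x ^ 2 + 12 * x + 3) / (x + 1) ^ 2) with (term 0 x)
    by (unfold term, num; simpl INR; cbn [weight]; field; lra).
  assert (Hb : forall n, 0 <= term (S n) x <= 32768 * (/ 2) ^ n).
  { intros n; split; [now apply term_bounds|].
    pose proof (num_bounds (INR (S n)) x (pos_INR _) Hx) as HP.
    pose proof (pos_INR (S n)) as Hn.
    set (m := INR (S n)) in *.
    apply Rle_trans with
      ((/ 16) ^ n / (x + 1) ^ 6 * (1024 * (m + 1) ^ 5 * (x + 1) ^ 4)).
    - apply Rmult_le_compat; [now apply weight_nonneg | apply HP |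
                                now apply weight_S_le_pow6|].
      eapply Rle_trans; [apply HP|].
      apply Rmult_le_compat_r; [apply pow_le; lra|].
      apply Rmult_le_compat_l; [lra|]. apply Rle_pow; [lra | lia].
    - pose proof (pow5_geom (S n)) as Hpg; fold m in Hpg; simpl pow in Hpg.
      replace (_ / _ * _) with
        (16384 * / (x + 1) ^ 2 * ((m + 1) ^ 5 * (/ 16 * (/ 16) ^ n)))
        by (field; lra).
      assert (Hinv : 0 <= / (x + 1) ^ 2 <= 1).
      { split; [apply Rlt_le, Rinv_0_lt_compat, pow_lt; lra|].
        rewrite <- Rinv_1; apply Rinv_le_contravar; [lra|]. nra. }
      apply Rle_trans with (16384 * 1 * (4 * (/ 2 * (/ 2) ^ n))); [|lra].
      apply Rmult_le_compat; [| | |exact Hpg]; try lra.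
      apply Rmult_le_pos; [apply pow_le; lra|].
      apply Rmult_le_pos; [lra|]. apply pow_le; lra. }
  rewrite E; replace (term 0 x + _ - term 0 x) with (Series (fun n => term (S n) x))
    by ring.
  split.
  - rewrite <- (Rmult_0_l (Series (fun _ => 0))), <- Series_scal_l.
    apply Series_le.
    + intros n; rewrite Rmult_0_l; split; [lra | apply Hb].
    + apply (ex_series_geom_half _ 32768); intros n.
      rewrite Rabs_pos_eq; apply Hb.
  - apply Rle_trans with (Rabs (Series (fun n => term (S n) x)));
      [apply Rle_abs|].
    replace 65536 with (2 * 32768) by ring.
    apply Series_geom_half_bound; intros n; rewrite Rabs_pos_eq; apply Hb.
Qed.

Lemma dterm_sum_bound x : 0 <= x -> Rabs (dterm_sum x) <= 88 * 1024 * (x + 1).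
Proof.
  intros Hx; replace (88 * 1024 * (x + 1)) with (2 * (44 * 1024 * (x + 1))) by ring.
  apply Series_geom_half_bound; intros n; now apply dterm_bound.
Qed.

(** The central binomial coefficient [C(2n,n)] divided by [4^n]; its fourth power
    is the product of the first [n] shift factors. *)
Fixpoint half_ratio (n : nat) : R :=
  match n with
  | O => 1
  | S m => half_ratio m * ((2 * INR m + 1) / (2 * INR m + 2))
  end.

Lemma term_sum_iter K : term_sum 0 = half_ratio K ^ 4 * term_sum (INR K).
Proof.
  induction K as [|K IH]; [simpl; ring|].
  pose proof (pos_INR K); rewrite IH, term_sum_shift, S_INR by lra.
  cbn [half_ratio]; unfold shift_factor; ring.
Qed.

Fixpoint dlog_shifts (n : nat) : R :=
  match n with
  | O => 0
  | S m => dlog_shifts m + dlog_shift (INR m)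
  end.

(** Each step adds [dlog_shift j] times [half_ratio (j+1) ^ 4 * term_sum (j+1)],
    and the latter is always [term_sum 0] by [term_sum_iter]. *)
Lemma dterm_sum_iter K :
  dterm_sum 0 =
  half_ratio K ^ 4 * dterm_sum (INR K) + dlog_shifts K * term_sum 0.
Proof.
  induction K as [|K IH]; [simpl; ring|].
  pose proof (pos_INR K); rewrite IH, dterm_sum_shift by lra.
  cbn [dlog_shifts]; rewrite Rmult_plus_distr_r.
  rewrite (term_sum_iter (S K)) at 3.
  rewrite S_INR; cbn [half_ratio]; unfold shift_factor; ring.
Qed.

(** * Wallis' product *)

Definition sin_integral (n : nat) : R := RInt (fun x => sin x ^ n) 0 (PI / 2).

Lemma is_RInt_sin_pow n : is_RInt (fun x => sin x ^ n) 0 (PI / 2) (sin_integral n).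
Proof.
  apply (RInt_correct (V := R_CompleteNormedModule)).
  apply (ex_RInt_continuous (V := R_CompleteNormedModule)).
  intros x _; apply (ex_derive_continuous (fun x => sin x ^ n)).
  auto_derive; exact I.
Qed.

(** Integrate the derivative of [- cos x * sin x ^ (n + 1)], which vanishes at
    both ends. *)
Lemma sin_integral_rec n :
  (INR n + 2) * sin_integral (n + 2) = (INR n + 1) * sin_integral n.
Proof.
  pose (F := fun x => - (cos x * sin x ^ (n + 1))).
  pose (f := fun x => (INR n + 2) * sin x ^ (n + 2) - (INR n + 1) * sin x ^ n).
  assert (HF : is_RInt f 0 (PI / 2) (F (PI / 2) - F 0)).
  { apply (is_RInt_derive F f); intros x _.
    - unfold F, f; auto_derive; [exact I|].
      replace (Init.Nat.pred (n + 1)) with n by lia.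
      rewrite !pow_add, plus_INR; simpl.
      pose proof (sin2_cos2 x) as Hsc; unfold Rsqr in Hsc.
      replace (cos x * (1 * cos x * ((INR n + 1) * sin x ^ n)))
        with ((1 - sin x * sin x) * ((INR n + 1) * sin x ^ n))
        by (replace (1 - sin x * sin x) with (cos x * cos x) by lra; ring).
      ring.
    - unfold f; apply (ex_derive_continuous
        (fun x => (INR n + 2) * sin x ^ (n + 2) - (INR n + 1) * sin x ^ n)).
      auto_derive; exact I. }
  assert (Hf : is_RInt f 0 (PI / 2)
                 ((INR n + 2) * sin_integral (n + 2) - (INR n + 1) * sin_integral n)).
  { apply (is_RInt_minus (fun x => (INR n + 2) * sin x ^ (n + 2))
                         (fun x => (INR n + 1) * sin x ^ n));
      [apply (is_RInt_scal (fun x => sin x ^ (n + 2)) _ _ (INR n + 2))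
      |apply (is_RInt_scal (fun x => sin x ^ n) _ _ (INR n + 1))];
      apply is_RInt_sin_pow. }
  apply (is_RInt_unique (V := R_CompleteNormedModule)) in HF, Hf.
  assert (E : F (PI / 2) - F 0 = 0).
  { unfold F; rewrite cos_PI2, sin_0, !pow_add; simpl; ring. }
  rewrite HF in Hf; lra.
Qed.

Lemma sin_integral_decr n : sin_integral (n + 1) <= sin_integral n.
Proof.
  pose proof PI_RGT_0.
  apply (is_RInt_le (fun x => sin x ^ (n + 1)) (fun x => sin x ^ n) 0 (PI / 2));
    [lra | apply is_RInt_sin_pow | apply is_RInt_sin_pow|].
  intros x Hx; rewrite pow_add, pow_1.
  assert (0 <= sin x) by (apply sin_ge_0; lra).
  pose proof (SIN_bound x).
  rewrite <- (Rmult_1_r (sin x ^ n)) at 2.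
  apply Rmult_le_compat_l; [now apply pow_le | lra].
Qed.

Lemma half_ratio_pos n : 0 < half_ratio n.
Proof.
  induction n as [|n IH]; cbn [half_ratio]; [lra|].
  pose proof (pos_INR n).
  apply Rmult_lt_0_compat; [exact IH|]. apply Rdiv_lt_0_compat; lra.
Qed.

Lemma sin_integral_even n : sin_integral (2 * n) = half_ratio n * (PI / 2).
Proof.
  induction n as [|n IH].
  - change (sin_integral (2 * 0)) with (RInt (fun _ => 1) 0 (PI / 2)).
    rewrite RInt_const; unfold scal; simpl; unfold mult; simpl; ring.
  - pose proof (sin_integral_rec (2 * n)) as Hrec.
    replace (2 * S n)%nat with (2 * n + 2)%nat by lia.
    rewrite IH, mult_INR in Hrec; change (INR 2) with 2 in Hrec.
    pose proof (pos_INR n); cbn [half_ratio].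
    apply (Rmult_eq_reg_l (2 * INR n + 2)); [|lra].
    rewrite Hrec; field; lra.
Qed.

Lemma sin_integral_odd n :
  (2 * INR n + 1) * half_ratio n * sin_integral (2 * n + 1) = 1.
Proof.
  induction n as [|n IH].
  - cbn [half_ratio Nat.mul Nat.add INR].
    assert (E : sin_integral 1 = 1).
    { unfold sin_integral; apply is_RInt_unique.
      replace 1 with (- cos (PI / 2) - - cos 0) by (rewrite cos_PI2, cos_0; ring).
      apply (is_RInt_derive (fun x => - cos x)); intros x _.
      - auto_derive; [exact I | ring].
      - apply (ex_derive_continuous (fun x => sin x ^ 1)); auto_derive; exact I. }
    rewrite E; ring.
  - pose proof (sin_integral_rec (2 * n + 1)) as Hrec.
    replace (2 * S n + 1)%nat with (2 * n + 1 + 2)%nat by lia.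
    rewrite plus_INR, mult_INR in Hrec; change (INR 2) with 2 in Hrec.
    change (INR 1) with 1 in Hrec.
    pose proof (pos_INR n); rewrite S_INR; cbn [half_ratio].
    replace ((2 * (INR n + 1) + 1) * (half_ratio n * ((2 * INR n + 1) / (2 * INR n + 2)))
              * sin_integral (2 * n + 1 + 2))
      with (half_ratio n * (2 * INR n + 1) / (2 * INR n + 2)
             * ((2 * INR n + 1 + 2) * sin_integral (2 * n + 1 + 2))) by (field; lra).
    rewrite Hrec; etransitivity; [|exact IH]; field; lra.
Qed.

(** The integral of [sin ^ (2n+1)] lies between those of [sin ^ (2n+2)] and
    [sin ^ (2n)]; the former is inversely and the latter two are directly
    proportional to [half_ratio]. *)
Lemma half_ratio_sq_bounds n :
  2 / PI <= (2 * INR n + 1) * half_ratio n ^ 2 <= 2 / PI * (1 + / (2 * INR n + 1)).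
Proof.
  pose proof PI_RGT_0 as Hpi; pose proof (pos_INR n) as Hn.
  pose proof (half_ratio_pos n) as Hu.
  pose proof (sin_integral_decr (2 * n)) as Hlo; rewrite sin_integral_even in Hlo.
  pose proof (sin_integral_decr (2 * n + 1)) as Hhi.
  replace (2 * n + 1 + 1)%nat with (2 * S n)%nat in Hhi by lia.
  rewrite sin_integral_even in Hhi; cbn [half_ratio] in Hhi.
  pose proof (sin_integral_odd n) as E.
  set (m := INR n) in *; set (w := sin_integral (2 * n + 1)) in *.
  set (v := half_ratio n) in *.
  assert (Hv : 0 < (2 * m + 1) * v) by (apply Rmult_lt_0_compat; lra).
  apply (Rmult_le_compat_l ((2 * m + 1) * v)) in Hlo; [|lra].
  apply (Rmult_le_compat_l ((2 * m + 1) * v)) in Hhi; [|lra].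
  rewrite E in Hlo, Hhi; split.
  - apply Rle_div_l; [lra|]. lra.
  - apply (Rmult_le_reg_r ((2 * m + 1) * PI / (2 * (2 * m + 2)))).
    { apply Rdiv_lt_0_compat; [apply Rmult_lt_0_compat|]; lra. }
    replace (2 / PI * (1 + / (2 * m + 1)) * _) with 1 by (field; lra).
    eapply Rle_trans; [|exact Hhi]. right; field; lra.
Qed.

(** * The logarithm of 2 *)

Lemma ln_sub_le a b : 0 < a -> 0 < b -> ln b - ln a <= b / a - 1.
Proof.
  intros Ha Hb; rewrite <- ln_div by assumption.
  pose proof (exp_ineq1_le (ln (b / a))) as He.
  rewrite exp_ln in He; [lra|]. now apply Rdiv_lt_0_compat.
Qed.

Lemma harmonic_S n : harmonic (S n) = harmonic n + / (INR n + 1).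
Proof.
  unfold harmonic; rewrite sum_n_Sm by lia; rewrite S_INR; reflexivity.
Qed.

Lemma harmonic_0 : harmonic 0 = 0.
Proof. unfold harmonic; rewrite sum_n_m_zero; [reflexivity | lia]. Qed.

Lemma harmonic_gap_ln n :
  ln 2 - / (2 * INR n + 1) <= harmonic (2 * n) - harmonic n <= ln 2.
Proof.
  (* [harmonic m - ln (m + 1)] increases and [harmonic m - ln m] decreases. *)
  assert (low : forall k, harmonic n - ln (INR n + 1)
                <= harmonic (n + k) - ln (INR (n + k) + 1)).
  { induction k as [|k IH]; [rewrite Nat.add_0_r; lra|].
    eapply Rle_trans; [exact IH|].
    rewrite Nat.add_succ_r, harmonic_S, S_INR; pose proof (pos_INR (n + k)).
    set (m := INR (n + k)) in *.
    pose proof (ln_sub_le (m + 1) (m + 1 + 1) ltac:(lra) ltac:(lra)) as Hl.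
    replace ((m + 1 + 1) / (m + 1) - 1) with (/ (m + 1)) in Hl by (field; lra).
    lra. }
  assert (up : forall k, (0 < n)%nat -> harmonic (n + k) - ln (INR (n + k))
                <= harmonic n - ln (INR n)).
  { intros k Hn; induction k as [|k IH]; [rewrite Nat.add_0_r; lra|].
    eapply Rle_trans; [|exact IH].
    rewrite Nat.add_succ_r, harmonic_S, S_INR.
    assert (0 < INR (n + k)) by (apply lt_0_INR; lia).
    set (m := INR (n + k)) in *.
    pose proof (ln_sub_le (m + 1) m ltac:(lra) ltac:(lra)) as Hl.
    replace (m / (m + 1) - 1) with (- / (m + 1)) in Hl by (field; lra).
    lra. }
  specialize (low n); pose proof (pos_INR n).
  replace (n + n)%nat with (2 * n)%nat in low by lia.
  rewrite mult_INR in low; change (INR 2) with 2 in low.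
  pose proof (ln_sub_le (2 * INR n + 1) (2 * (INR n + 1)) ltac:(lra) ltac:(lra)) as Hl.
  rewrite (ln_mult 2) in Hl by lra.
  replace (2 * (INR n + 1) / (2 * INR n + 1) - 1) with (/ (2 * INR n + 1)) in Hl
    by (field; lra).
  split; [lra|].
  destruct n as [|n].
  - simpl; rewrite harmonic_0. pose proof ln_lt_2; lra.
  - specialize (up (S n) ltac:(lia)).
    replace (S n + S n)%nat with (2 * S n)%nat in up by lia.
    rewrite mult_INR in up; change (INR 2) with 2 in up.
    rewrite ln_mult in up; [lra | lra |]. apply lt_0_INR; lia.
Qed.

Lemma dlog_shifts_harmonic n : dlog_shifts n = 8 * (harmonic (2 * n) - harmonic n).
Proof.
  induction n as [|n IH]; [simpl; rewrite harmonic_0; ring|].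
  replace (2 * S n)%nat with (S (S (2 * n))) by lia.
  rewrite !harmonic_S, S_INR, mult_INR; cbn [dlog_shifts].
  rewrite IH; unfold dlog_shift.
  change (INR 2) with 2; pose proof (pos_INR n); field; lra.
Qed.

(** * The values of the two sums at 0 *)

Lemma lim_inv_odd : is_lim_seq (fun n => / (2 * INR n + 1)) 0.
Proof.
  apply (is_lim_seq_le_le_loc (fun _ => 0) _ (fun n => / INR n)).
  - exists 1%nat; intros n Hn.
    assert (0 < INR n) by (apply lt_0_INR; lia).
    split; [apply Rlt_le, Rinv_0_lt_compat; lra|].
    apply Rinv_le_contravar; lra.
  - apply is_lim_seq_const.
  - replace (Finite 0) with (Rbar_inv p_infty) by reflexivity.
    apply is_lim_seq_inv; [apply is_lim_seq_INR | discriminate].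
Qed.

Lemma is_lim_seq_of_inv_odd_bound f l c :
  (forall n, Rabs (f n - l) <= c * / (2 * INR n + 1)) -> is_lim_seq f l.
Proof.
  intros Hf.
  apply (is_lim_seq_le_le (fun n => l - c * / (2 * INR n + 1)) _
                          (fun n => l + c * / (2 * INR n + 1))).
  - intros n; specialize (Hf n); apply Rabs_le_between in Hf; lra.
  - replace (Finite l) with (Finite (l - c * 0)) by (f_equal; ring).
    apply is_lim_seq_minus'; [apply is_lim_seq_const|].
    apply (is_lim_seq_scal_l _ c 0), lim_inv_odd.
  - replace (Finite l) with (Finite (l + c * 0)) by (f_equal; ring).
    apply is_lim_seq_plus'; [apply is_lim_seq_const|].
    apply (is_lim_seq_scal_l _ c 0), lim_inv_odd.
Qed.

Lemma lim_half_ratio_sq :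
  is_lim_seq (fun n => (2 * INR n + 1) * half_ratio n ^ 2) (2 / PI).
Proof.
  apply (is_lim_seq_of_inv_odd_bound _ _ (2 / PI)); intros n.
  pose proof (half_ratio_sq_bounds n); rewrite Rabs_pos_eq; lra.
Qed.

Lemma lim_dlog_shifts : is_lim_seq dlog_shifts (8 * ln 2).
Proof.
  apply (is_lim_seq_of_inv_odd_bound _ _ 8); intros n; rewrite dlog_shifts_harmonic.
  pose proof (harmonic_gap_ln n); apply Rabs_le_between; lra.
Qed.

(** Wallis' product in the form used for both sums: [half_ratio n ^ 4] extracts
    the coefficient of quadratic growth. *)
Lemma lim_half_ratio_pow4 f (l : R) :
  is_lim_seq (fun n => f n / (2 * INR n + 1) ^ 2) l ->
  is_lim_seq (fun n => half_ratio n ^ 4 * f n) ((2 / PI) ^ 2 * l).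
Proof.
  intros Hf.
  apply (is_lim_seq_ext (fun n => ((2 * INR n + 1) * half_ratio n ^ 2)
     * ((2 * INR n + 1) * half_ratio n ^ 2) * (f n / (2 * INR n + 1) ^ 2))).
  - intros n; pose proof (pos_INR n); field; lra.
  - replace ((2 / PI) ^ 2) with (2 / PI * (2 / PI)) by ring.
    apply is_lim_seq_mult'; [|exact Hf].
    apply is_lim_seq_mult'; apply lim_half_ratio_sq.
Qed.

Lemma term_sum_0 : term_sum 0 = 32 / PI ^ 2.
Proof.
  assert (Hlim : is_lim_seq (fun n => half_ratio n ^ 4 * term_sum (INR n))
                   ((2 / PI) ^ 2 * 8)).
  { apply lim_half_ratio_pow4, (is_lim_seq_of_inv_odd_bound _ _ 100000); intros n.
    pose proof (pos_INR n) as Hn; pose proof (term_sum_asymptotic (INR n) Hn) as HS.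
    set (m := INR n) in *.
    set (s := term_sum m - _) in HS.
    replace (term_sum m / (2 * m + 1) ^ 2 - 8) with
      (s * / (2 * m + 1) * / (2 * m + 1) - (4 * m + 5) / (m + 1) ^ 2)
      by (unfold s; field; lra).
    assert (Hi : 0 < / (2 * m + 1) <= 1).
    { split; [apply Rinv_0_lt_compat; lra|].
      rewrite <- Rinv_1; apply Rinv_le_contravar; lra. }
    assert (H1 : 0 <= s * / (2 * m + 1) * / (2 * m + 1) <= 65536 * / (2 * m + 1) * 1).
    { split; [repeat apply Rmult_le_pos; lra|].
      apply Rmult_le_compat; try lra; [apply Rmult_le_pos; lra|].
      apply Rmult_le_compat_r; lra. }
    assert (H2 : 0 <= (4 * m + 5) / (m + 1) ^ 2 <= 10 * / (2 * m + 1)).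
    { split.
      - apply Rlt_le, Rdiv_lt_0_compat; [lra | apply pow_lt; lra].
      - apply Rle_div_l; [apply pow_lt; lra|].
        apply (Rmult_le_reg_r (2 * m + 1)); [lra|].
        replace (10 * / (2 * m + 1) * (m + 1) ^ 2 * (2 * m + 1))
          with (10 * (m + 1) ^ 2) by (field; lra). nra. }
    apply Rabs_le_between; lra. }
  apply (is_lim_seq_ext _ (fun _ => term_sum 0)) in Hlim;
    [|intros n; symmetry; apply term_sum_iter].
  apply is_lim_seq_unique in Hlim; rewrite Lim_seq_const in Hlim.
  injection Hlim as Hlim; rewrite Hlim; pose proof PI_RGT_0; field; lra.
Qed.

Lemma dterm_sum_0 : dterm_sum 0 = 256 * ln 2 / PI ^ 2.
Proof.
  assert (Hlim : is_lim_seq (fun n => half_ratio n ^ 4 * dterm_sum (INR n)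
                                     + dlog_shifts n * term_sum 0)
                ((2 / PI) ^ 2 * 0 + 8 * ln 2 * term_sum 0)).
  { apply is_lim_seq_plus'.
    - apply lim_half_ratio_pow4, (is_lim_seq_of_inv_odd_bound _ _ (88 * 1024)).
      intros n.
      pose proof (pos_INR n) as Hn; pose proof (dterm_sum_bound (INR n) Hn) as HT.
      set (m := INR n) in *.
      replace (dterm_sum m / (2 * m + 1) ^ 2 - 0) with (dterm_sum m * / (2 * m + 1) ^ 2)
        by (field; lra).
      rewrite Rabs_mult, (Rabs_pos_eq (/ _)).
      + apply Rle_trans with (88 * 1024 * (2 * m + 1) * / (2 * m + 1) ^ 2).
        * apply Rmult_le_compat_r; [|lra].
          apply Rlt_le, Rinv_0_lt_compat, pow_lt; lra.
        * right; field; lra.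
      + apply Rlt_le, Rinv_0_lt_compat, pow_lt; lra.
    - apply is_lim_seq_mult'; [apply lim_dlog_shifts | apply is_lim_seq_const]. }
  apply (is_lim_seq_ext _ (fun _ => dterm_sum 0)) in Hlim;
    [|intros n; symmetry; apply dterm_sum_iter].
  apply is_lim_seq_unique in Hlim; rewrite Lim_seq_const in Hlim.
  injection Hlim as Hlim; rewrite Hlim, term_sum_0; pose proof PI_RGT_0; field; lra.
Qed.

(** * The binomial form of the summand *)

Lemma central_binomial_S n :
  Binomial.C (2 * S n) (S n)
  = Binomial.C (2 * n) n * (2 * (2 * INR n + 1) / (INR n + 1)).
Proof.
  unfold Binomial.C.
  replace (2 * S n - S n)%nat with (S n) by lia.
  replace (2 * n - n)%nat with n by lia.
  replace (2 * S n)%nat with (S (S (2 * n))) by lia.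
  rewrite !fact_simpl, !mult_INR, !S_INR, mult_INR; change (INR 2) with 2.
  pose proof (INR_fact_neq_0 n); pose proof (pos_INR n).
  field; split; [lra | assumption].
Qed.

Definition summand_coefficient (n : nat) : R :=
  Binomial.C (2 * n) n ^ 4 * Binomial.C (4 * n) (2 * n) / 2 ^ (16 * n).

(** The factor [(2 n + 1) ^ 2] undoes the square of the last factor of
    [(x+1)_{2n+1}]; correspondingly [num n 0] is divisible by it. *)
Lemma weight_0 n : weight n 0 * (2 * INR n + 1) ^ 2 = summand_coefficient n.
Proof.
  induction n as [|n IH].
  - unfold summand_coefficient, Binomial.C; simpl; field.
  - pose proof (pos_INR n) as Hn.
    assert (E : summand_coefficient (S n) = summand_coefficient n *
      ((2 * (2 * INR n + 1) / (INR n + 1)) ^ 4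
       * (2 * (4 * INR n + 1) / (2 * INR n + 1))
       * (2 * (4 * INR n + 3) / (2 * INR n + 2)) / 2 ^ 16)).
    { unfold summand_coefficient.
      replace (4 * n)%nat with (2 * (2 * n))%nat by lia.
      replace (4 * S n)%nat
        with (2 * S (S (2 * n)))%nat by lia.
      replace (2 * S n)%nat with (S (S (2 * n))) at 2
        by lia.
      rewrite !central_binomial_S.
      replace (16 * S n)%nat with (16 * n + 16)%nat by lia.
      rewrite pow_add, S_INR, mult_INR; change (INR 2) with 2.
      pose proof (pow_lt 2 (16 * n) ltac:(lra)).
      field; repeat split; lra. }
    rewrite E, <- IH; cbn [weight]; rewrite S_INR; unfold weight_ratio.
    field; lra.
Qed.

Lemma dlog_weight_0 n :
  dlog_weight n 0 = 2 * (harmonic (2 * n) - 2 * harmonic n) - 2 / (2 * INR n + 1).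
Proof.
  induction n as [|n IH].
  - cbn [dlog_weight]; simpl; rewrite harmonic_0; field.
  - replace (2 * S n)%nat with (S (S (2 * n))) by lia.
    rewrite !harmonic_S; cbn [dlog_weight]; rewrite IH, !S_INR, mult_INR.
    change (INR 2) with 2; pose proof (pos_INR n); field; repeat split; lra.
Qed.

(** The rational part [- 2 / (2 n + 1)] of [dlog_weight n 0] combines with
    [dnum n 0] into the polynomial [68 n + 9]. *)
Lemma half_dterm_0 n :
  / 2 * dterm n 0 = summand_coefficient n *
    ((120 * INR n ^ 2 + 34 * INR n + 3) * (harmonic (2 * n) - 2 * harmonic n)
     + 68 * INR n + 9).
Proof.
  rewrite <- weight_0; unfold dterm, num, dnum; rewrite dlog_weight_0.
  pose proof (pos_INR n); field; lra.
Qed.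

Theorem theorem1p7 :
  is_series
    (fun k : nat =>
       Binomial.C (2 * k) k ^ 4 * Binomial.C (4 * k) (2 * k) / 2 ^ (16 * k) *
       ((120 * INR k ^ 2 + 34 * INR k + 3) * (harmonic (2 * k) - 2 * harmonic k)
        + 68 * INR k + 9))
    (128 * ln 2 / PI ^ 2).
Proof.
  replace (128 * ln 2 / PI ^ 2) with (/ 2 * dterm_sum 0).
  2: { rewrite dterm_sum_0; field; apply PI_neq0. }
  apply (is_series_ext (fun n => / 2 * dterm n 0)).
  - exact half_dterm_0.
  - apply (is_series_scal_l (/ 2) (fun n => dterm n 0)), is_series_dterm; lra.
Qed.
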